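(* Let $\alpha\in(0,1)$, let $\mu\in\ell^\infty(S)$ and assume that the family, indexed by $s\in S$, of random intervals $[\hat l(s),\hat u(s)]$ forms a $(1-\alpha)$-simultaneous confidence band for $\mu$. Then $$\mathbb{P}_*\Big[\forall c\in\mathcal{F}(S):\ \hat{\mathcal{U}}_c\subseteq\mathcal{U}_c\ \wedge\ \hat{\mathcal{L}}_c\subseteq\mathcal{L}_c\Big]\ge1-\alpha.$$
   Context: $S$ is a metric space, $\mathcal{F}(S)$ the set of functions $S\to\mathbb{R}\cup\{\pm\infty\}$, $\ell^\infty(S)$ the bounded real functions on $S$, $(\Omega,\mathfrak{P},\mathbb{P})$ a probability space with inner probability $\mathbb{P}_*$. For $c\in\mathcal{F}(S)$: $\mathcal{U}_c=\{s\in S:\mu(s)>c(s)\}$, $\mathcal{L}_c=\{s\in S:\mu(s)<c(s)\}$, and the estimated sets are the excursion sets of the band's boundaries: $\hat{\mathcal{U}}_c=\{s\in S:\hat l(s)>c(s)\}$, $\hat{\mathcal{L}}_c=\{s\in S:\hat u(s)<c(s)\}$. The intervals form a $(1-\alpha)$-simultaneous confidence band (SCB) for $\mu$ if $\mathbb{P}_*[\forall s\in S:\hat l(s)\le\mu(s)\le\hat u(s)]\ge1-\alpha$. *)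

(* Defs.v *)
(* MathComp / MathComp-Analysis *)
From HB Require Import structures.
From mathcomp Require Import all_boot all_order all_algebra.
From mathcomp Require Import all_classical all_reals all_analysis.

Set Implicit Arguments.
Unset Strict Implicit.
Unset Printing Implicit Defensive.

Import Order.TTheory GRing.Theory Num.Theory.
Import numFieldNormedType.Exports.

Local Open Scope classical_set_scope.
Local Open Scope ring_scope.
Local Open Scope ereal_scope.

(* Meaningful for every A, measurable or not. *)
Definition inner_probability (R : realType) (d : measure_display)
    (Omega : measurableType d) (P : probability Omega R) (A : set Omega)
    : \bar R :=
  ereal_sup [set P B | B in [set B | measurable B /\ B `<=` A]].

Definition upper_excursion (R : realType) (S : Type) (f c : S -> \bar R)
    : set S := [set s | f s > c s].

Definition lower_excursion (R : realType) (S : Type) (f c : S -> \bar R)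
    : set S := [set s | f s < c s].

(* The endpoints of the random intervals take values in [-oo, +oo], which
   covers one-sided bands, and are arbitrary functions on Omega: the use of an
   inner probability makes measurability of the endpoints unnecessary. *)
Definition simultaneous_confidence_band (R : realType) (d : measure_display)
    (Omega : measurableType d) (P : probability Omega R) (S : Type)
    (alpha : R) (lhat uhat : S -> Omega -> \bar R) (mu : S -> R) : Prop :=
  inner_probability P
    [set w | forall s : S, lhat s w <= (mu s)%:E <= uhat s w]
  >= (1 - alpha)%:E.

(* Main.v *)
Require Import Defs.
From HB Require Import structures.
From mathcomp Require Import all_boot all_order all_algebra.
From mathcomp Require Import all_classical all_reals all_analysis.

Set Implicit Arguments.
Unset Strict Implicit.
Unset Printing Implicit Defensive.

Import Order.TTheory GRing.Theory Num.Theory.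
Import numFieldNormedType.Exports.

Local Open Scope classical_set_scope.
Local Open Scope ring_scope.
Local Open Scope ereal_scope.

(** The argument is deterministic, outcome by outcome. Where the band covers [mu] at every point,
    transitivity gives c(s) < lhat(s) <= mu(s) on the estimated upper set and mu(s) <= uhat(s) <
    c(s) on the estimated lower set. Hence the coverage event lies inside the inclusion event, and
    monotonicity of inner probability transfers the bound. *)

(** Enlarging the set enlarges the family of measurable subsets over which the supremum is taken;
    neither [A] nor [B] has to be measurable. *)
Lemma le_inner_probability (R : realType) (d : measure_display)
    (Omega : measurableType d) (P : probability Omega R) (A B : set Omega) :
  A `<=` B -> inner_probability P A <= inner_probability P B.
Proof.
move=> AB; apply: ereal_sup_le => _ [C [mC CA] <-].
by exists C => //; split => //; exact: subset_trans CA AB.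
Qed.

Theorem proposition2 (R : realType) (d : measure_display)
    (Omega : measurableType d) (P : probability Omega R) (S : metricType R)
    (alpha : R) (alpha_gt0 : (0 < alpha)%R) (alpha_lt1 : (alpha < 1)%R)
    (mu : S -> R) (mu_bounded : bounded_fun mu)
    (lhat uhat : S -> Omega -> \bar R)
    (scb : simultaneous_confidence_band P alpha lhat uhat mu) :
  inner_probability P
    [set w | forall c : S -> \bar R,
       upper_excursion (fun s => lhat s w) c
         `<=` upper_excursion (fun s => (mu s)%:E) c /\
       lower_excursion (fun s => uhat s w) c
         `<=` lower_excursion (fun s => (mu s)%:E) c]
  >= (1 - alpha)%:E.
Proof.
(* The hypothesis [band] on the outcome [w] does not mention [c], so uniformity over all thresholds
   costs no probability. *)
apply: (le_trans scb); apply: le_inner_probability => w /= band c.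
split=> s; rewrite /upper_excursion /lower_excursion /= => cs.
- by case/andP: (band s) => lmu _; exact: lt_le_trans cs lmu.
- by case/andP: (band s) => _ muu; exact: le_lt_trans muu cs.
Qed.
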